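(* Let $\ell \geq 2$ and let $G$ be a $K_{\ell}$-critical claw-free graph with $\chi(G) \leq 5\ell - 4$. Then $G$ is a complete graph.
   Context: All graphs are finite and simple. $\chi(G)$ denotes the chromatic number. A graph is claw-free if it has no induced subgraph isomorphic to $K_{1,3}$. For $\ell \geq 2$, a graph $G$ is called $K_{\ell}$-critical if (i) $G$ contains $K_{\ell}$ as a subgraph; (ii) $G$ is critical, i.e. removing any vertex reduces the chromatic number of $G$ by one; (iii) removing the vertex set of any copy of $K_{\ell}$ in $G$ reduces the chromatic number of $G$ by exactly $\ell$. *)

(* Defs.v *)
From mathcomp Require Import all_boot.

Set Implicit Arguments.
Unset Strict Implicit.
Unset Printing Implicit Defensive.

Record sgraph := SGraph {
  svertex :> finType;
  sedge : rel svertex;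
  sedge_sym : symmetric sedge;
  sedge_irrefl : irreflexive sedge
}.

Notation "x -- y" := (sedge x y) (at level 30, no associativity).

Section Induced.
Variables (G : sgraph) (A : {set G}).

Definition induced_edge : rel {x : G | x \in A} :=
  fun x y => val x -- val y.

Lemma induced_edge_sym : symmetric induced_edge.
Proof. by move=> x y; rewrite /induced_edge sedge_sym. Qed.

Lemma induced_edge_irrefl : irreflexive induced_edge.
Proof. by move=> x; rewrite /induced_edge sedge_irrefl. Qed.

Definition induced : sgraph := SGraph induced_edge_sym induced_edge_irrefl.

End Induced.

Definition remove_vertices (G : sgraph) (A : {set G}) : sgraph :=
  induced (~: A).

Section CompleteGraph.
Variable n : nat.

Definition complete_edge : rel 'I_n := fun x y => x != y.

Lemma complete_edge_sym : symmetric complete_edge.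
Proof. by move=> x y; rewrite /complete_edge eq_sym. Qed.

Lemma complete_edge_irrefl : irreflexive complete_edge.
Proof. by move=> x; rewrite /complete_edge eqxx. Qed.

Definition complete_sgraph : sgraph :=
  SGraph complete_edge_sym complete_edge_irrefl.

End CompleteGraph.

Section CompleteBipartiteGraph.
Variables m n : nat.

Definition is_left (x : 'I_m + 'I_n) : bool :=
  if x is inl _ then true else false.

Definition bipartite_edge : rel ('I_m + 'I_n)%type :=
  fun x y => is_left x != is_left y.

Lemma bipartite_edge_sym : symmetric bipartite_edge.
Proof. by move=> x y; rewrite /bipartite_edge eq_sym. Qed.

Lemma bipartite_edge_irrefl : irreflexive bipartite_edge.
Proof. by move=> x; rewrite /bipartite_edge eqxx. Qed.

Definition complete_bipartite_sgraph : sgraph :=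
  SGraph bipartite_edge_sym bipartite_edge_irrefl.

End CompleteBipartiteGraph.

(* Copy of H in G as a not necessarily induced subgraph. *)
Definition subgraph_embedding (H G : sgraph) (f : H -> G) : Prop :=
  injective f /\ forall x y : H, x -- y -> f x -- f y.

Definition induced_embedding (H G : sgraph) (f : H -> G) : Prop :=
  injective f /\ forall x y : H, f x -- f y = x -- y.

Definition claw_free (G : sgraph) : Prop :=
  ~ exists f : complete_bipartite_sgraph 1 3 -> G, induced_embedding f.

Definition is_complete (G : sgraph) : Prop :=
  forall x y : G, x != y -> x -- y.

Definition colorable (G : sgraph) (k : nat) : bool :=
  [exists c : {ffun G -> 'I_k},
    [forall x, forall y, (x -- y) ==> (c x != c y)]].

Lemma colorable_exists (G : sgraph) : exists k, colorable G k.
Proof.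
exists #|G|; apply/existsP; exists [ffun x => enum_rank x].
apply/forallP=> x; apply/forallP=> y; apply/implyP=> xy.
rewrite !ffunE (inj_eq enum_rank_inj); apply: contraTneq xy => ->.
by rewrite sedge_irrefl.
Qed.

Definition chi (G : sgraph) : nat := ex_minn (colorable_exists G).

(* The decreases of chi are written additively because subtraction on nat is
   truncated. *)
Definition critical (G : sgraph) : Prop :=
  forall v : G, chi (remove_vertices [set v]) + 1 = chi G.

Definition K_critical (l : nat) (G : sgraph) : Prop :=
  [/\ exists f : complete_sgraph l -> G, subgraph_embedding f,
      critical G
    & forall f : complete_sgraph l -> G, subgraph_embedding f ->
        chi (remove_vertices [set f x | x : complete_sgraph l]) + l = chi G].

(* Main.v *)
Require Import Defs.
From mathcomp Require Import all_boot zify.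

(* Write k for the chromatic number and suppose that G has no clique of size k.
   In a (k - l)-colouring of G - K, where K is an l-clique, every class contains
   a vertex complete to K. Hence K has at least k - l common neighbours, not all
   pairwise adjacent, and every vertex not complete to K misses one of them.
   Replacing vertices of K by common neighbours then builds, around a vertex v
   of K, an l-clique K' containing v such that at least 3l - 4 neighbours of v
   lie outside K' and are not complete to it; so v has degree at least
   (l - 1) + (k - l) + (3l - 4) = k + 3l - 5.
   Moreover v can be chosen so that some vertex y adjacent to v has l neighbours
   missed by v; as G is claw-free they form an l-clique A. In a
   (k - l)-colouring of G - A, each colour other than that of v occurs at most
   twice around v, so v has degree at most 2(k - l - 1), whence k >= 5l - 3. *)

Set Implicit Arguments.
Unset Strict Implicit.
Unset Printing Implicit Defensive.

(** * Cliques, missed neighbours, and colourings after removing a set *)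

Definition clique (G : sgraph) (C : {set G}) : bool :=
  [forall x in C, forall y in C, (x != y) ==> (x -- y)].

Definition neighbors (G : sgraph) (v : G) : {set G} := [set u | v -- u].

Definition common_neighbors (G : sgraph) (C : {set G}) : {set G} :=
  [set u | [forall a in C, u -- a]].

Definition l_clique (G : sgraph) (l : nat) (K : {set G}) : bool :=
  clique K && (#|K| == l).

(** The test [s != u] keeps a member of [S] from counting as missed by itself; if [S] lies in a
    clique, none of its members is then missed. *)
Definition missed_neighbors (G : sgraph) (v : G) (S : {set G}) : {set G} :=
  [set u in neighbors v | [exists s in S, (s != u) && ~~ (s -- u)]].

Section Cliques.
Variable G : sgraph.
Implicit Types (x y v : G) (C K : {set G}).

Lemma cliqueP C :
  reflect {in C &, forall x y, x != y -> x -- y} (clique C).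
Proof.
apply: (iffP forall_inP) => [h x y xC yC|h x xC].
  by move/forall_inP: (h x xC) => /(_ y yC) /implyP.
by apply/forall_inP => y yC; apply/implyP; apply: h.
Qed.

Lemma common_neighborsP C x :
  reflect {in C, forall a, x -- a} (x \in common_neighbors C).
Proof. by rewrite inE; apply: forall_inP. Qed.

Lemma common_neighbors_notin C x : x \in common_neighbors C -> x \notin C.
Proof.
by move/common_neighborsP => h; apply/negP => /h; rewrite sedge_irrefl.
Qed.

Lemma sedge_neq x y : x -- y -> x != y.
Proof. by apply: contraTneq => ->; rewrite sedge_irrefl. Qed.

Lemma clique_sub C K : C \subset K -> clique K -> clique C.
Proof.
move=> /subsetP sCK /cliqueP hK; apply/cliqueP => x y xC yC.
by apply: hK; apply: sCK.
Qed.

Lemma cliqueU C K :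
  clique C -> clique K -> {in C & K, forall x y, x -- y} -> clique (C :|: K).
Proof.
move=> /cliqueP hC /cliqueP hK hCK; apply/cliqueP => x y.
rewrite !inE => /orP[xC|xK] /orP[yC|yK] nxy; try exact: hC; try exact: hK.
  exact: hCK.
by rewrite sedge_sym; apply: hCK.
Qed.

Lemma l_clique_swap l K f w :
  l_clique l K -> f \in K -> {in K :\ f, forall a, w -- a} ->
  w \notin K -> l_clique l (w |: K :\ f).
Proof.
move=> /andP[cK /eqP sK] fK hw wK; apply/andP; split.
  apply: cliqueU; last by move=> x y /set1P ->; apply: hw.
    by apply/cliqueP => x y /set1P -> /set1P ->; rewrite eqxx.
  exact: clique_sub (subD1set K f) cK.
rewrite cardsU1 !inE (negPf wK) andbF /= -sK.
by rewrite (cardsD1 f K) fK.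
Qed.

Lemma subset_of_card (T : finType) (D : {set T}) n :
  n <= #|D| -> exists2 A : {set T}, A \subset D & #|A| = n.
Proof.
move=> hn; exists [set x in take n (enum D)].
  apply/subsetP => x; rewrite inE => /mem_take.
  by rewrite mem_enum.
rewrite cardsE; have /card_uniqP -> : uniq (take n (enum D)).
  by rewrite take_uniq ?enum_uniq.
by rewrite size_take -cardE; case: ltnP => // h; apply/eqP; rewrite eqn_leq h hn.
Qed.

(** Renumber the colours that occur. An arbitrary colour type [T] lets the recolouring argument
    below use a sum type. *)
Lemma chi_le_image (T : finType) (c : G -> T) :
  (forall x y, x -- y -> c x != c y) -> chi G <= #|c @: [set: G]|.
Proof.
move=> hc; rewrite /chi; case: ex_minnP => k _; apply.
have cin x : c x \in c @: [set: G] by apply: imset_f; rewrite inE.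
apply/existsP; exists [ffun x => enum_rank_in (cin x) (c x)].
apply/forallP => x; apply/forallP => y; apply/implyP => /hc.
rewrite !ffunE; apply: contraNneq => h.
rewrite -(enum_rankK_in (cin x) (cin x)) -(enum_rankK_in (cin y) (cin y)).
by rewrite h.
Qed.

(** An optional colour on all of [G], with [None] marking the removed vertices, keeps later
    arguments off the subtype. *)
Lemma chi_remove_coloring C :
  exists c : G -> option 'I_(chi (remove_vertices C)),
    (forall x, (c x == None) = (x \in C)) /\
    (forall x y, x \notin C -> y \notin C -> x -- y -> c x != c y).
Proof.
have : colorable (remove_vertices C) (chi (remove_vertices C)).
  by rewrite /chi; case: ex_minnP.
case/existsP => c /forallP h.
exists (fun x => omap (fun u : {x : G | x \in ~: C} => c u) (insub x)).
split=> [x|x y xC yC xy].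
  by case: insubP => [u|]; rewrite inE ?negbK => // /negPf ->.
case: insubP => [u _ eu|]; last by rewrite inE xC.
case: insubP => [w _ ew|]; last by rewrite inE yC.
rewrite /= (inj_eq Some_inj).
move: (h u) => /forallP/(_ w)/implyP; apply.
by rewrite -eu -ew in xy.
Qed.

Lemma clique_card_le_chi_remove (A C : {set G}) :
  clique C -> [disjoint A & C] -> #|C| <= chi (remove_vertices A).
Proof.
move=> /cliqueP hC dAC; have [c [c0 hc]] := chi_remove_coloring A.
have CA x : x \in C -> x \notin A by move/(disjointFl dAC) ->.
have cI : {in C &, injective c}.
  move=> x y xC yC exy; have [//|/hC hxy] := eqVneq x y.
  by move: (hc x y (CA _ xC) (CA _ yC) (hxy xC yC)); rewrite exy eqxx.
rewrite -(card_in_imset cI) -[X in _ <= X]card_ord.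
rewrite -[X in _ <= X](card_imset _ (@Some_inj _)).
apply/subset_leq_card/subsetP => _ /imsetP[x /CA xA ->].
by case E: (c x) => [i|]; [apply: imset_f | move: xA; rewrite -c0 E].
Qed.

End Cliques.

(** * Colour classes and the common neighbours of an l-clique *)

Section LClique.
Variables (G : sgraph) (l : nat) (K : {set G}).
Hypothesis lK : l_clique l K.
Hypothesis chiK : chi (remove_vertices K) + l = chi G.

(* If a colour class had no vertex complete to [K], each of its vertices could
   take the colour of a vertex of [K] it misses, saving one colour. *)
Lemma colour_class_meets_common (c : G -> option 'I_(chi (remove_vertices K))) :
    (forall x, (c x == None) = (x \in K)) ->
    (forall x y, x \notin K -> y \notin K -> x -- y -> c x != c y) ->
  forall i, exists2 u, u \in common_neighbors K & c u = Some i.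
Proof.
move=> c0 hc i.
have [/exists_inP[u uK /eqP cu]|none] :=
  boolP [exists u in common_neighbors K, c u == Some i]; first by exists u.
have miss x : c x = Some i -> exists a, (a \in K) && ~~ (x -- a).
  move=> cx; move: none; rewrite negb_exists_in => /forall_inP/(_ x).
  rewrite cx eqxx /= => hx.
  have : x \notin common_neighbors K by apply/negP => /hx.
  by rewrite inE negb_forall_in => /exists_inP[a aK xa]; exists a; rewrite aK.
(* The surviving colours are [inl j], and [inr a] is the colour of the vertex [a] of [K]. By [miss]
   the pick succeeds on class [i], so the default [x] never occurs. *)
pose rep x := if c x is Some j then
    if j == i then inr (odflt x [pick a | (a \in K) && ~~ (x -- a)]) else inl j
  else inr x : 'I_(chi (remove_vertices K)) + G.
have repK x : x \in K -> rep x = inr x.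
  by rewrite -c0 /rep => /eqP ->.
have repi x : c x = Some i -> exists2 a, rep x = inr a & (a \in K) && ~~ (x -- a).
  move=> cx; rewrite /rep cx eqxx; case: pickP => [a ha|h]; first by exists a.
  by have [a] := miss x cx; rewrite h.
have repj x j : c x = Some j -> j != i -> rep x = inl j.
  by rewrite /rep => -> /negPf ->.
have repP x : [\/ x \in K, c x = Some i | exists2 j, c x = Some j & j != i].
  case E: (c x) => [j|]; last by apply: Or31; rewrite -c0 E.
  by have [->|nj] := eqVneq j i; [apply: Or32 | apply: Or33; exists j].
have nK x j : c x = Some j -> x \notin K by move=> cx; rewrite -c0 cx.
have rep_proper x y : x -- y -> rep x != rep y.
  move=> xy; have nxy := sedge_neq xy.
  have /cliqueP cK : clique K by case/andP: lK.
  case: (repP x) => [xK|cx|[j cx ji]]; case: (repP y) => [yK|cy|[j' cy ji']].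
  - by rewrite !repK //; apply: contraNneq nxy => -[->].
  - have [a -> /andP[aK ya]] := repi _ cy; rewrite repK //.
    by apply: contraNneq ya => -[<-]; rewrite sedge_sym.
  - by rewrite repK // (repj _ _ cy).
  - have [a -> /andP[aK xa]] := repi _ cx; rewrite repK //.
    by apply: contraNneq xa => -[->].
  - by have := hc _ _ (nK _ _ cx) (nK _ _ cy) xy; rewrite cx cy eqxx.
  - by have [a -> _] := repi _ cx; rewrite (repj _ _ cy).
  - by rewrite (repK y) // (repj _ _ cx).
  - by have [a -> _] := repi _ cy; rewrite (repj _ _ cx).
  - rewrite (repj _ _ cx) // (repj _ _ cy) //.
    have := hc _ _ (nK _ _ cx) (nK _ _ cy) xy; rewrite cx cy.
    by apply: contraNneq => -[->].
have := chi_le_image rep_proper.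
(* Class [i] has disappeared, so at most [chi (remove_vertices K) - 1 + l] colours are left, fewer
   than [chi G]. *)
have : rep @: [set: G] \subset inl @: [set~ i] :|: inr @: K.
  apply/subsetP => _ /imsetP[x _ ->]; case: (repP x) => [xK|cx|[j cx ji]].
  - by rewrite repK // inE [X in _ || X]imset_f ?orbT.
  - by have [a -> /andP[aK _]] := repi _ cx; rewrite inE [X in _ || X]imset_f ?orbT.
  - by rewrite (repj _ _ cx) // inE imset_f // !inE.
move=> /subset_leq_card h1 h2; have := leq_trans h2 h1.
have {h1 h2} [+ _] := leq_card_setU
  (inl @: [set~ i]) (inr @: K : {set 'I_(chi (remove_vertices K)) + G}).
rewrite !card_imset; try by move=> ? ? [].
have /andP[_ /eqP ->] := lK; have := cardsC1 i; rewrite card_ord.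
have := ltn_ord i; move: chiK; lia.
Qed.

(** Distinct colour classes supply distinct common neighbours, and there are [chi G - l] classes. *)
Lemma card_common_ge : chi G <= l + #|common_neighbors K|.
Proof.
have [c [c0 hc]] := chi_remove_coloring K.
rewrite -chiK addnC leq_add2l -[X in X <= _]card_ord.
rewrite -[X in X <= _](card_imset _ (@Some_inj _)).
apply: leq_trans (leq_imset_card c _); apply: subset_leq_card.
apply/subsetP => _ /imsetP[i _ ->].
have [u uK <-] := colour_class_meets_common c0 hc i.
exact: imset_f.
Qed.

(** The colour class of [t] contains a common neighbour of [K]; sharing its colour, [t] is not
    adjacent to it. *)
Lemma exists_common_nonadjacent t :
    t \notin K -> t \notin common_neighbors K ->
  exists u, [/\ u \in common_neighbors K, u != t & ~~ (t -- u)].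
Proof.
move=> tK tN; have [c [c0 hc]] := chi_remove_coloring K.
case E: (c t) => [i|]; last by move: tK; rewrite -c0 E.
have [u uN cu] := colour_class_meets_common c0 hc i; exists u; split=> //.
  by apply: contraNneq tN => <-.
apply/negP => /(hc _ _ tK (common_neighbors_notin uN)).
by rewrite E cu eqxx.
Qed.

End LClique.

(** * Consequences of criticality and of claw-freeness *)

Lemma l_clique_chi_remove (G : sgraph) (l : nat) (K : {set G}) :
  K_critical l G -> l_clique l K -> chi (remove_vertices K) + l = chi G.
Proof.
move=> [_ _ hcrit] /andP[/cliqueP cK /eqP sK].
pose f (i : complete_sgraph l) : G := enum_val (cast_ord (esym sK) i).
have f_inj : injective f by move=> i j /enum_val_inj /cast_ord_inj.
have fK : [set f x | x : complete_sgraph l] = K.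
  apply/setP => x; apply/imsetP/idP => [[i _ ->]|xK]; first exact: enum_valP.
  exists (cast_ord sK (enum_rank_in xK x)) => //.
  by rewrite /f cast_ordK enum_rankK_in.
rewrite -{1}fK; apply: hcrit; split=> // i j ij.
by apply: cK; rewrite ?enum_valP // (inj_eq f_inj).
Qed.

(** Deleting a vertex outside [C] would leave [C] intact, so the chromatic number could not drop. *)
Lemma critical_clique_complete (G : sgraph) (C : {set G}) :
  critical G -> clique C -> chi G <= #|C| -> is_complete G.
Proof.
move=> hcrit cC hC; have inC x : x \in C.
  apply/negPn/negP => xC; have := hcrit x.
  have : [disjoint [set x] & C] by rewrite disjoints1.
  by move/(clique_card_le_chi_remove cC); lia.
by move=> x y; move/cliqueP: cC; apply.
Qed.

Lemma claw_free_neighbors (G : sgraph) (v a b c : G) :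
    claw_free G -> v -- a -> v -- b -> v -- c ->
    a != b -> a != c -> b != c ->
  [|| a -- b, a -- c | b -- c].
Proof.
move=> hG va vb vc ab ac bc; apply/negPn/negP.
rewrite !negb_or => /and3P[nab nac nbc]; apply: hG.
exists (fun x : complete_bipartite_sgraph 1 3 =>
  match x with inl _ => v | inr i => nth v [:: a; b; c] i end).
have := (sedge_neq va, sedge_neq vb, sedge_neq vc).
move=> [[nva nvb] nvc].
split=> [[i|[[|[|[|//]]] hi]] [j|[[|[|[|//]]] hj]] /= e|
         [i|[[|[|[|//]]] hi]] [j|[[|[|[|//]]] hj]] /=];
  try by [congr inr; apply: val_inj | rewrite (ord1 i) (ord1 j)
         | move: nva nvb nvc ab ac bc; rewrite e !eqxx].
all: rewrite ?sedge_irrefl ?va ?vb ?vc //.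
all: rewrite sedge_sym ?va ?vb ?vc ?(negPf nab) ?(negPf nac) ?(negPf nbc) //.
all: by rewrite sedge_sym ?(negPf nab) ?(negPf nac) ?(negPf nbc).
Qed.

(** * Lower bound on degrees when no clique has [chi G] vertices *)

Section KCritical.
Variables (G : sgraph) (l : nat).
Hypothesis l_gt1 : 1 < l.
Hypothesis chi_l : forall K : {set G},
  l_clique l K -> chi (remove_vertices K) + l = chi G.
Hypothesis small_cliques : forall C : {set G}, clique C -> #|C| < chi G.
Implicit Types (v w f t u : G) (K S D : {set G}).

(** Otherwise [K] together with its common neighbours would be a clique of at least [chi G]
    vertices. *)
Lemma common_neighbors_nonclique K : l_clique l K ->
  exists w w', [/\ w \in common_neighbors K, w' \in common_neighbors K,
    w != w' & ~~ (w -- w')].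
Proof.
move=> lK; have := card_common_ge lK (chi_l lK).
have [cN|] := boolP (clique (common_neighbors K)).
  have cKN : clique (K :|: common_neighbors K).
    apply: cliqueU => // [|x y xK /common_neighborsP hy].
      by case/andP: lK.
    by rewrite sedge_sym hy.
  have := small_cliques cKN.
  have := leq_card_setU K (common_neighbors K); case=> _.
  have /andP[_ /eqP ->] := lK.
  have -> : [disjoint K & common_neighbors K].
    rewrite disjoint_sym disjoint_subset.
    by apply/subsetP => x /common_neighbors_notin.
  by move/eqP; clear; lia.
rewrite negb_forall_in => /exists_inP[w wN].
rewrite negb_forall_in => /exists_inP[w' wN'].
by rewrite negb_imply => /andP[ww' nww'] _; exists w, w'.
Qed.

Lemma l_clique_swap_common K v f w :
    l_clique l K -> v \in K -> f \in K -> f != v -> w \in common_neighbors K ->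
  l_clique l (w |: K :\ f) /\ v \in w |: K :\ f.
Proof.
move=> lK vK fK fv wN; split; last by rewrite !inE (eq_sym v f) fv vK orbT.
apply: l_clique_swap (common_neighbors_notin wN) => // a.
by rewrite inE => /andP[_]; move/common_neighborsP: wN; apply.
Qed.

Lemma l_clique_other K v : l_clique l K -> exists2 f, f \in K & f != v.
Proof.
move=> /andP[_ /eqP sK]; have /set0Pn[f] : K :\ v != set0.
  by rewrite -card_gt0; move: (cardsD1 v K); lia.
by rewrite !inE => /andP[fv fK]; exists f.
Qed.

(** Extremal argument: an l-clique through [v] that meets [D] in as many vertices as possible lies
    in [D] apart from [v], and one further common neighbour also lies in [D]. *)
Lemma nonneighbors_ge K v w w' :
    l_clique l K -> v \in K ->
    w \in common_neighbors K -> w' \in common_neighbors K ->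
    w != w' -> ~~ (w -- w') ->
  l <= #|missed_neighbors v [set w]|.
Proof.
move=> lK vK wN wN' ww' nww'; set D := missed_neighbors v [set w].
have DP u : (u \in D) = [&& v -- u, w != u & ~~ (w -- u)].
  rewrite !inE; congr (_ && _); apply/exists_inP/andP => [[s /set1P ->]|].
    by move/andP.
  by case=> h1 h2; exists w; rewrite ?inE ?h1.
have vw : v -- w by rewrite sedge_sym; move/common_neighborsP: wN; apply.
have vD : v \notin D by rewrite DP sedge_irrefl.
pose good K' := [&& l_clique l K', v \in K' & K' :&: D != set0].
have [f fK fv] := l_clique_other v lK.
have [lK0 vK0] := l_clique_swap_common lK vK fK fv wN'.
(* The maximum must be taken over cliques meeting [D]: a vertex of [D] in [K1] ensures that [w] is
   not complete to [K1]. Here [w'] is such a vertex. *)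
have good0 : good (w' |: K :\ f).
  rewrite /good lK0 vK0; apply/set0Pn; exists w'.
  rewrite in_setI DP ww' nww' !inE eqxx /= andbT.
  by rewrite sedge_sym; move/common_neighborsP: wN'; apply.
case: (arg_maxnP (fun K' : {set G} => #|K' :&: D|) good0) => K1.
case/and3P=> lK1 vK1 /set0Pn[d /setIP[dK1 dD]] K1max.
have /and3P[_ wd nwd] : [&& v -- d, w != d & ~~ (w -- d)] by rewrite -DP.
have wK1 : w \notin K1.
  apply: contraNN nwd => wK1.
  by have /andP[/cliqueP cK1 _] := lK1; apply: cK1.
have wN1 : w \notin common_neighbors K1.
  by apply: contraNN nwd => /common_neighborsP; apply.
have [u [uN uw nwu]] := exists_common_nonadjacent lK1 (chi_l lK1) wK1 wN1.
have uK1 := common_neighbors_notin uN.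
have uD : u \in D.
  rewrite DP (eq_sym w) uw nwu !andbT sedge_sym.
  by move/common_neighborsP: uN; apply.
(* Exchanging a vertex [g] outside [D] for [u] would enlarge the intersection with [D]. *)
have K1D : K1 :\ v \subset D.
  apply/subsetP => g /setD1P[gv gK1]; apply/negPn/negP => gD.
  have [lK2 vK2] := l_clique_swap_common lK1 vK1 gK1 gv uN.
  have lt12 : K1 :&: D \proper (u |: K1 :\ g) :&: D.
    apply/properP; split.
      apply/subsetP => x /setIP[xK1 xD]; rewrite in_setI xD andbT !inE xK1 andbT.
      by apply/orP; right; apply: contraNneq gD => <-.
    exists u; first by rewrite in_setI uD !inE eqxx.
    by rewrite in_setI (negPf uK1).
  have : good (u |: K1 :\ g).
    rewrite /good lK2 vK2 -card_gt0; exact: leq_ltn_trans (proper_card lt12).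
  by move/K1max => /=; rewrite leqNgt (proper_card lt12).
have : u |: K1 :\ v \subset D by rewrite subUset sub1set uD.
move/subset_leq_card; rewrite cardsU1 !inE (negPf uK1) andbF /=.
have /andP[_ /eqP <-] := lK1.
by rewrite (cardsD1 v K1) vK1.
Qed.

(* Greedy construction: the first vertex of [S] misses at least [l] neighbours
   of [v], and each further one at least two new ones. *)
Lemma missed_neighbors_greedy K v j :
    l_clique l K -> v \in K -> 0 < j < l ->
  exists K' S, [/\ l_clique l K', v \in K', S \subset K' :\ v, #|S| = j
    & l + 2 * j.-1 <= #|missed_neighbors v S|].
Proof.
move=> lK vK; elim: j => // -[_ _|j IHj /andP[_ jl]].
  have [w [w' [wN wN' ww' nww']]] := common_neighbors_nonclique lK.
  have [f fK fv] := l_clique_other v lK.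
  have [lK0 vK0] := l_clique_swap_common lK vK fK fv wN.
  exists (w |: K :\ f), [set w]; split=> //; last first.
  - by rewrite muln0 addn0; apply: nonneighbors_ge wN wN' ww' nww'.
  - by rewrite cards1.
  rewrite sub1set !inE eqxx andbT.
  by apply: contraNneq (common_neighbors_notin wN) => ->.
have [|K1 [S [lK1 vK1 SK1 sS hS]]] := IHj; first by lia.
have [w [w' [wN wN' ww' nww']]] := common_neighbors_nonclique lK1.
(* Since [S] has fewer than [l - 1] vertices, some [f] can be exchanged without disturbing [v] or
   [S]. *)
have [f fK1 fS] : exists2 f, f \in K1 :\ v & f \notin S.
  apply/subsetPn; apply: contraL jl => /subset_leq_card.
  have /andP[_ /eqP sK1] := lK1.
  by have := cardsD1 v K1; rewrite vK1 sK1 sS; lia.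
have {fK1} [fv fK1] := setD1P fK1.
have [lKw vKw] := l_clique_swap_common lK1 vK1 fK1 fv wN.
have [lKw' vKw'] := l_clique_swap_common lK1 vK1 fK1 fv wN'.
have wK1 := common_neighbors_notin wN.
have SP x : x \in S -> [/\ x \in K1, x != v & x != f].
  move=> xS; have /setD1P[xv xK1] := subsetP SK1 _ xS; split=> //.
  by apply: contraNneq fS => <-.
have SKf x0 : S \subset x0 |: K1 :\ f.
  by apply/subsetP => x /SP[xK1 _ xf]; rewrite !inE xf xK1 orbT.
have wKw' : w \notin w' |: K1 :\ f.
  by rewrite !inE negb_or ww' (negPf wK1) andbF.
have wNw' : w \notin common_neighbors (w' |: K1 :\ f).
  apply: contraNN nww' => /common_neighborsP; apply.
  by rewrite !inE eqxx.
(* The two new vertices missed by [w] are [w'] and this [u], found after exchanging [f] for [w'].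
   Both are complete to [S], hence not counted before. *)
have [u [uN uw nwu]] :=
  exists_common_nonadjacent lKw' (chi_l lKw') wKw' wNw'.
have wS : w \notin S by apply: contraNN wK1 => /SP[].
exists (w |: K1 :\ f), (w |: S); split=> //.
- rewrite subUset sub1set !inE eqxx andbT; apply/andP; split.
    by apply: contraNneq wK1 => ->.
  by apply/subsetP => x /SP[xK1 xv xf]; rewrite !inE xv xf xK1 orbT.
- by rewrite cardsU1 wS sS.
have missN x : x \in common_neighbors S -> x \notin missed_neighbors v S.
  move=> /common_neighborsP xS; rewrite inE; apply/nandP; right.
  rewrite negb_exists_in; apply/forall_inP => s sS'.
  by rewrite (sedge_sym s) xS // andbF.
have missW x : v -- x -> w != x -> ~~ (w -- x) -> x \in missed_neighbors v (w |: S).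
  move=> vx wx nwx; rewrite !inE vx; apply/exists_inP; exists w.
    by rewrite !inE eqxx.
  by rewrite wx.
have uw' : u != w'.
  by apply: contraNneq (common_neighbors_notin uN) => ->; rewrite !inE eqxx.
have sub : [set u; w'] :|: missed_neighbors v S \subset missed_neighbors v (w |: S).
  rewrite !subUset !sub1set; apply/andP; split; first (apply/andP; split).
  - apply: missW => //; last by rewrite eq_sym.
    by rewrite sedge_sym; move/common_neighborsP: uN; apply.
  - apply: missW => //.
    by rewrite sedge_sym; move/common_neighborsP: wN'; apply.
  apply/subsetP => x; rewrite !inE => /andP[-> /exists_inP[s sS' hs]] /=.
  by apply/exists_inP; exists s => //; rewrite !inE sS' orbT.
have := subset_leq_card sub; rewrite cardsU cards2 uw'.
have -> : [set u; w'] :&: missed_neighbors v S = set0.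
  apply/eqP; rewrite -subset0; apply/subsetP => x /setIP[/set2P[]->].
    apply: contraTT => _; apply: missN; apply/common_neighborsP => a aS.
    by move/common_neighborsP: uN; apply; apply: (subsetP (SKf w')).
  apply: contraTT => _; apply: missN; apply/common_neighborsP => a /SP[aK1 _ _].
  by move/common_neighborsP: wN'; apply.
by rewrite cards0; move: hS; clear; lia.
Qed.

(** With [l - 1] greedy steps [S] becomes [K' :\ v]. The neighbours of [v] then include three
    disjoint sets: [S], the common neighbours of [K'], and at least [l + 2 * (l - 2)] missed
    ones. *)
Lemma degree_ge K v :
  l_clique l K -> v \in K -> chi G + 3 * l <= #|neighbors v| + 5.
Proof.
move=> lK vK; have hj : 0 < l.-1 < l by move: l_gt1; clear; lia.
have [K' [S [lK' vK' SK' sS hS]]] := missed_neighbors_greedy lK vK hj.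
have /andP[/cliqueP cK' /eqP sK'] := lK'.
have {SK'} ES : S = K' :\ v.
  apply/eqP; rewrite eqEcard SK' sS.
  by have := cardsD1 v K'; rewrite vK' sK'; lia.
have SN : S \subset neighbors v.
  by apply/subsetP => x; rewrite ES !inE => /andP[xv xK']; rewrite cK' // eq_sym.
have CN : common_neighbors K' \subset neighbors v.
  by apply/subsetP => x /common_neighborsP xN; rewrite inE sedge_sym xN.
have MN : missed_neighbors v S \subset neighbors v.
  by apply/subsetP => x; rewrite inE => /andP[].
have : S :|: common_neighbors K' :|: missed_neighbors v S \subset neighbors v.
  by rewrite !subUset SN CN.
move/subset_leq_card; rewrite !cardsU.
have -> : S :&: common_neighbors K' = set0.
  apply/eqP; rewrite -subset0; apply/subsetP => x /setIP[xS].
  by move/common_neighbors_notin; move: xS; rewrite ES inE => /andP[_ ->].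
have -> : (S :|: common_neighbors K') :&: missed_neighbors v S = set0.
  apply/eqP; rewrite -subset0; apply/subsetP => x /setIP[xSN].
  rewrite inE => /andP[_ /exists_inP[s]]; rewrite {1}ES => /setD1P[sv sK1].
  case/andP=> sx; case/setUP: xSN => [|/common_neighborsP xN].
    by rewrite ES => /setD1P[xv xK1]; rewrite cK'.
  by rewrite sedge_sym xN.
have := card_common_ge lK' (chi_l lK'); rewrite !cards0.
by move: hS sS l_gt1; clear; lia.
Qed.

End KCritical.

(** * Upper bound on the degree, and the conclusion *)

Lemma degree_le (G : sgraph) (A : {set G}) (v : G) :
    claw_free G -> v \notin A -> [disjoint A & neighbors v] ->
  #|neighbors v| + 2 <= 2 * chi (remove_vertices A).
Proof.
move=> claw vA dA; have [c [c0 hc]] := chi_remove_coloring A.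
case Ev: (c v) => [i|]; last by move: vA; rewrite -c0 Ev.
have NA x : x \in neighbors v -> x \notin A by move/(disjointFl dA) ->.
(* Three neighbours of one colour would be the leaves of a claw centred at [v]. *)
have fiber j : #|[set x in neighbors v | c x == Some j]| <= 2.
  rewrite leqNgt; apply/negP => /card_gt2P[a [b [d]]].
  rewrite !inE => -[[/andP[va /eqP ca] /andP[vb /eqP cb] /andP[vd /eqP cd]]].
  move=> [ab bd da]; rewrite eq_sym in da.
  have nonadj x y : v -- x -> v -- y -> c x = Some j -> c y = Some j -> x -- y -> False.
    move=> vx vy cx cy xy.
    by have := hc x y; rewrite !NA ?inE // cx cy eqxx => /(_ isT isT xy).
  by case/or3P: (claw_free_neighbors claw va vb vd ab da bd); apply: nonadj.
(* All neighbours of [v] are coloured, as they avoid [A], and none has the colour [i] of [v]; the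
   default in [odflt] is never reached. *)
have -> : #|neighbors v| = \sum_(j | j != i) #|[set x in neighbors v | c x == Some j]|.
  rewrite -sum1_card (partition_big (fun x => odflt i (c x)) (fun j => j != i)) /=.
    apply: eq_bigr => j ji; rewrite -sum1_card; apply: eq_bigl => x.
    rewrite [RHS]inE; have [xN|//] := boolP (x \in neighbors v).
    case E: (c x) => [j'|]; first by rewrite (inj_eq Some_inj).
    by move: (NA _ xN); rewrite -c0 E.
  move=> x xN; have := NA _ xN; rewrite -c0; case E: (c x) => [j|] //= _.
  rewrite inE in xN.
  have := hc v x vA (NA _ _); rewrite inE xN => /(_ isT isT).
  by rewrite Ev E (inj_eq Some_inj) eq_sym.
apply: (@leq_trans (\sum_(j | j != i) 2 + 2)).
  by rewrite leq_add2r; apply: leq_sum => j _; apply: fiber.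
rewrite sum_nat_const (eq_card (B := predC1 i)) // cardC1 card_ord.
by have := ltn_ord i; clear; lia.
Qed.

Theorem theorem7 (l : nat) (G : sgraph) (hl : 2 <= l)
    (hcrit : K_critical l G) (hclaw : claw_free G)
    (hchi : chi G <= 5 * l - 4) :
  is_complete G.
Proof.
have [[f [f_inj f_edge]] crit _] := hcrit.
have chi_l K := @l_clique_chi_remove G l K hcrit.
have [/existsP[C /andP[cC hC]]|small] :=
  boolP [exists C : {set G}, clique C && (chi G <= #|C|)].
  exact: critical_clique_complete hC.
have {}small (C : {set G}) : clique C -> #|C| < chi G.
  move=> cC; rewrite ltnNge; apply: contraNN small => hC.
  by apply/existsP; exists C; rewrite cC.
pose K := [set f x | x : complete_sgraph l].
have lK : l_clique l K.
  rewrite /l_clique card_imset // card_ord eqxx andbT; apply/cliqueP.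
  move=> _ _ /imsetP[i _ ->] /imsetP[j _ ->] fij; apply: f_edge.
  by apply: contraNneq fij => ->.
have l0 : 0 < l by lia.
have yK : f (Ordinal l0) \in K by apply: imset_f.
set y := f _ in yK.
have [v [w [vN wN vw nvw]]] := common_neighbors_nonclique chi_l small lK.
have := nonneighbors_ge hl chi_l lK yK vN wN vw nvw.
case/subset_of_card => A /subsetP AD sA.
have AP x : x \in A -> [/\ y -- x, v != x & ~~ (v -- x)].
  move/AD; rewrite !inE => /andP[-> /exists_inP[s /set1P ->]].
  by case/andP.
have yv : y -- v by rewrite sedge_sym; move/common_neighborsP: vN; apply.
(* Two nonadjacent vertices of [A] would form with [v] the leaves of a claw centred at [y]. *)
have lA : l_clique l A.
  rewrite /l_clique sA eqxx andbT; apply/cliqueP => a b aA bA ab.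
  have [ya va nva] := AP a aA; have [yb vb nvb] := AP b bA.
  have := claw_free_neighbors hclaw yv ya yb va vb ab.
  by rewrite (negPf nva) (negPf nvb).
have vA : v \notin A by apply/negP => /AP[_]; rewrite eqxx.
have dA : [disjoint A & neighbors v].
  by rewrite disjoint_subset; apply/subsetP => x /AP[_ _ nvx]; rewrite !inE.
(* Exchanging [g] for [v] puts [v] into an l-clique, so that the lower bound applies to it. *)
have [g gK gy] := l_clique_other hl y lK.
have [lK' _] := l_clique_swap_common lK yK gK gy vN.
have vK' : v \in v |: K :\ g by rewrite !inE eqxx.
have := degree_ge hl chi_l small lK' vK'.
have := degree_le hclaw vA dA; have := chi_l A lA.
(* The bounds give [chi G + 3 * l - 5 <= 2 * (chi G - l) - 2], that is [5 * l - 3 <= chi G]. *)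
by move: hl hchi; clear; lia.
Qed.
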